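(* There exists an absolute constant $c>0$ such that for every integer $n\ge1$ and every $1\le k\le n$ there is a unital $k$-positive map $\Phi:M_n\to M_n$ with $\|\Phi\|_{cb}\ge c\sqrt{n/k}$. In particular $d_k(M_n)\ge c\sqrt{n/k}$.
   Context: $\|\Phi\|_{cb}=\sup_m\|\mathrm{id}_m\otimes\Phi\|$ (operator norms). $d_k(\mathcal S)=\sup\{\|\phi\|_{cb}:\phi:\mathcal S\to\mathcal T\text{ unital and }k\text{-positive},\ \mathcal T\text{ any operator system}\}$, where $k$-positive means $\mathrm{id}_k\otimes\phi$ is positive. *)

(* Defs.v *)
From HB Require Import structures.
From mathcomp Require Import all_boot all_order all_algebra.
From mathcomp Require Import complex.
From mathcomp Require Import all_classical all_reals ereal.
From mathcomp Require Import Rstruct.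
Set Implicit Arguments. Unset Strict Implicit. Unset Printing Implicit Defensive.
Import Order.TTheory GRing.Theory Num.Theory.
Local Open Scope ring_scope.
Local Open Scope classical_set_scope.

Notation R := Rdefinitions.R.
Notation C := (R[i])%type.

Definition cabs2 (z : C) : R := (complex.Re z) ^+ 2 + (complex.Im z) ^+ 2.

Definition vnorm (p : nat) (v : 'cV[C]_p) : R :=
  Num.sqrt (\sum_(i < p) cabs2 (v i 0)).

Definition opnorm (p : nat) (A : 'M[C]_p) : R :=
  sup [set vnorm (A *m v) | v in [set v : 'cV[C]_p | vnorm v <= 1]].

Definition mapnorm (p : nat) (T : 'M[C]_p -> 'M[C]_p) : R :=
  sup [set opnorm (T X) | X in [set X : 'M[C]_p | opnorm X <= 1]].

(* positive (semidefinite) matrices: v^* A v >= 0 for all v;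
   in C = R[i], 0 <= z means z is real and nonnegative *)
Definition psd (p : nat) (A : 'M[C]_p) : Prop :=
  forall v : 'cV[C]_p, 0 <= ((map_mx conjc v)^T *m A *m v) 0 0.

(* M_m(M_n) is identified with M_(m*n); the entry at rows (i,a), columns (j,b)
   is at (mxvec_index i a, mxvec_index j b).  unidx is the inverse bijection. *)
Definition unidx (m n : nat) (p : 'I_(m * n)) : 'I_m * 'I_n :=
  enum_val (cast_ord (esym (mxvec_cast m n)) p).

Definition blk (m n : nat) (X : 'M[C]_(m * n)) (i j : 'I_m) : 'M[C]_n :=
  \matrix_(a, b) X (mxvec_index i a) (mxvec_index j b).

Definition amp (m n : nat) (Phi : 'M[C]_n -> 'M[C]_n) (X : 'M[C]_(m * n))
  : 'M[C]_(m * n) :=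
  \matrix_(p, q) Phi (blk X (unidx p).1 (unidx q).1) (unidx p).2 (unidx q).2.

Definition unital (n : nat) (Phi : 'M[C]_n -> 'M[C]_n) : Prop :=
  Phi 1%:M = 1%:M.

Definition kpositive (k n : nat) (Phi : 'M[C]_n -> 'M[C]_n) : Prop :=
  forall X : 'M[C]_(k * n), psd X -> psd (@amp k n Phi X).

Definition cbnorm (n : nat) (Phi : 'M[C]_n -> 'M[C]_n) : \bar R :=
  ereal_sup [set (mapnorm (@amp m n Phi))%:E | m in [set m : nat | (0 < m)%N]].

(* Main.v *)
(* Random Choi matrices.  Let G be a symmetric matrix on C^n (x) C^n with random
   signs G_(ia),(jb) for i <> j and a <> b and zeros elsewhere, and let Phi have
   Choi matrix W = 1/n + t G; the zeros make Phi unital.  Evaluating Phi on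
   x x^* shows that k-positivity of Phi means <psi, W psi> >= 0 for every psi of
   Schmidt rank at most k, that is, for every n x n matrix psi of rank at most k.
   With positive probability |<psi, G psi>| <= C sqrt(r n) |psi|^2 for all real
   psi of rank r, both for r = 2k (real and imaginary parts of complex psi) and
   for r = n, so t = 1 / (C n sqrt(2kn)) is admissible, and the operator norm of G
   and of its flip G' is at most C n.  Testing (1 + G' / (C n)) / 2 against the
   maximally entangled vector bounds the cb norm below by about
   t |G|_2^2 / (2 C n^2), which has order sqrt(n/k).

   For the bound on G write psi = X Y with X a partial isometry, and round X and
   Y, suitably scaled, to integer matrices.  Since G vanishes for i = j and for
   a = b, the form is affine in each entry of X and of Y, so the rounding can be
   chosen not to decrease <psi, G psi>, at a controlled increase of |psi|^2.
   There remains a union bound over e^(O(rn)) pairs of integer matrices, each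
   with a subgaussian tail. *)
Require Import Defs.
From HB Require Import structures.
From mathcomp Require Import all_boot all_order all_algebra.
From mathcomp Require Import complex.
From mathcomp Require Import all_classical all_reals ereal.
From mathcomp Require Import Rstruct.
From mathcomp Require Import sequences exp spectral sesquilinear ring lra zify.
Import Order.TTheory GRing.Theory Num.Theory.
Set Implicit Arguments. Unset Strict Implicit. Unset Printing Implicit Defensive.
Local Open Scope ring_scope.

(** * Signs and nets *)

Definition sgn (K : realType) (b : bool) : K := (-1) ^+ b.

(** Subgaussian moment of one sign, with 2 in place of the sharp 1/2. For x^2 < 1/2,
    [1 + y <= expR y] at y = x and y = -x bounds the sum by 2 / (1 - x^2); for x^2 >= 1/2 both
    exponents are already at most 2 x^2. *)
Lemma sum_expR_sgn (K : realType) (x : K) :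
  \sum_(b : bool) expR (sgn K b * x) <= 2 * expR (2 * x ^+ 2).
Proof.
rewrite big_bool /sgn /= expr1 expr0 mul1r mulN1r.
wlog x0 : x / 0 <= x.
  move=> H; case: (leP 0 x) => [/H//|xlt].
  by have := H (- x); rewrite opprK sqrrN addrC; apply; lra.
have [h|h] := leP (1 / 2) (x ^+ 2); last first.
  set y := x ^+ 2 in h *.
  have x1 : x < 1 by rewrite -(@expr_lt1 _ 2%N)// -/y; lra.
  have e1 : expR (- x) <= (1 + x)^-1.
    by rewrite expRN lef_pV2 ?posrE ?expR_gt0 ?expR_ge1Dx//; lra.
  have e2 : expR x <= (1 - x)^-1.
    rewrite -[x in expR x]opprK expRN lef_pV2 ?posrE ?expR_gt0 ?expR_ge1Dx//.
    by rewrite subr_gt0.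
  have e3 := expR_ge1Dx (2 * y).
  apply: (le_trans (lerD e1 e2)); apply: le_trans (_ : 2 * (1 + 2 * y) <= _).
    have -> : (1 + x)^-1 + (1 - x)^-1 = 2 / (1 - y).
      have n1 : 1 - x != 0 by rewrite lt0r_neq0// subr_gt0.
      have n2 : 1 + x != 0 by rewrite lt0r_neq0//; lra.
      have -> : 1 - y = (1 - x) * (1 + x) by rewrite /y; ring.
      by field; rewrite n1 n2.
    rewrite ler_pdivrMr; last lra.
    have : 0 <= y * (1 - 2 * y) by rewrite mulr_ge0 ?sqr_ge0//; lra.
    by nra.
  by rewrite ler_pM2l//.
have xle : x <= 2 * x ^+ 2.
  by nra.
have a1 : expR x <= expR (2 * x ^+ 2) by rewrite ler_expR.
have a2 : expR (- x) <= expR (2 * x ^+ 2) by rewrite ler_expR; lra.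
by lra.
Qed.

Lemma sum_expR_signs (K : realType) (P : finType) (c : P -> K) :
  \sum_(e : {ffun P -> bool}) expR (\sum_p sgn K (e p) * c p)
    <= 2 ^+ #|P| * expR (2 * \sum_p c p ^+ 2).
Proof.
have -> : \sum_(e : {ffun P -> bool}) expR (\sum_p sgn K (e p) * c p)
  = \prod_p \sum_b expR (sgn K b * c p).
  by rewrite bigA_distr_bigA; apply: eq_bigr => e _; rewrite expR_sum.
have -> : 2 ^+ #|P| * expR (2 * \sum_p c p ^+ 2)
   = \prod_p (2 * expR (2 * c p ^+ 2)).
  rewrite big_split /= prodr_const mulr_sumr.
  by congr (_ * _); rewrite expR_sum; apply: eq_bigl => i.
apply: ler_prod => p _; rewrite sum_expR_sgn andbT.
by apply: sumr_ge0 => b _; exact: expR_ge0.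
Qed.

Lemma sum_half_pow (K : realType) (Q : nat) :
  \sum_(a < Q) (2^-1 : K) ^+ a <= 2.
Proof.
have -> : \sum_(a < Q) (2^-1 : K) ^+ a = 2 - 2 * 2^-1 ^+ Q.
  elim: Q => [|Q IH]; first by rewrite big_ord0 expr0; lra.
  by rewrite big_ord_recr /= IH exprS; lra.
have : 0 <= (2^-1 : K) ^+ Q by apply: exprn_ge0; lra.
by lra.
Qed.

(* An integer is coded by a sign and an absolute value at most Q. *)
Definition net (D : finType) (Q : nat) := {ffun D -> bool * 'I_Q.+1}.

(* Each admissible z has weight at least 1 in the product of the sums of
   2^(-|z_p|), up to the factor 2^Q. *)
Lemma card_net (K : realType) (D : finType) (Q : nat) :
  (#|[set z : net D Q | (\sum_p (z p).2 ^ 2 <= Q)%N]|)%:R <= 2 ^+ Q * 4 ^+ #|D| :> K.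
Proof.
rewrite -sum1_card natr_sum.
apply: (@le_trans _ _ (\sum_(z : net D Q)
    2 ^+ Q * \prod_p (2^-1 : K) ^+ (z p).2)).
  rewrite [leRHS](bigID (mem [set z : net D Q | (\sum_p (z p).2 ^ 2 <= Q)%N])) /=.
  rewrite -[leLHS]addr0; apply: lerD; last first.
    apply: sumr_ge0 => z _; rewrite mulr_ge0 ?exprn_ge0 ?prodr_ge0//.
  apply: ler_sum => z /=; rewrite inE => hz.
  rewrite prodrXr exprVn ler_pdivlMr ?exprn_gt0// mul1r ler_eXn2l ?ltr1n//.
  apply: leq_trans hz; apply: leq_sum => p _.
  by case: (nat_of_ord (z p).2) => // a; rewrite expnS leq_pmulr// expn_gt0.
rewrite -mulr_sumr; apply: ler_wpM2l; first exact: exprn_ge0.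
rewrite -(bigA_distr_bigA (fun (p : D) (x : bool * 'I_Q.+1) => (2^-1 : K) ^+ x.2)).
rewrite -[leRHS]prodr_const; apply: ler_prod => p _; apply/andP; split.
  by apply: sumr_ge0 => x _; apply: exprn_ge0; lra.
(* Two signs times a geometric sum at most 2 give the factor 4 per coordinate. *)
rewrite -(pair_big predT predT (fun (b : bool) (a : 'I_Q.+1) => (2^-1 : K) ^+ a)) /=.
rewrite big_bool /=; have := sum_half_pow K Q.+1; lra.
Qed.

(** * Integer rounding *)

(* Moving one coordinate to one of its two integer neighbours, in the direction
   in which the linear term does not decrease f, costs at most g. *)
Lemma integer_rounding (K : archiRealFieldType) (m p : nat)
    (f : 'M[K]_(m, p) -> K) (g : 'I_m * 'I_p -> K) :
  (forall q, 0 <= g q) ->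
  (forall (X : 'M[K]_(m, p)) q, exists b, forall d,
     f (X + d *: delta_mx q.1 q.2) = f X + b * d - g q * d ^+ 2) ->
  forall X : 'M[K]_(m, p), exists Z : 'M[int]_(m, p),
    (forall i j, `|(Z i j)%:~R - X i j| <= 1) /\
    f X - \sum_q g q <= f (map_mx intr Z).
Proof.
move=> g0 fq X.
(* Generalized for induction on the list of coordinates already rounded; off the list [X'] still
   agrees with [X]. *)
suff [X' [hin [_ hf]]] : exists X' : 'M[K]_(m, p),
    (forall q, q \in enum {: 'I_m * 'I_p} ->
       X' q.1 q.2 \is a Num.int /\ `|X' q.1 q.2 - X q.1 q.2| <= 1) /\
    (forall q, q \notin enum {: 'I_m * 'I_p} -> X' q.1 q.2 = X q.1 q.2) /\
    f X - \sum_(q <- enum {: 'I_m * 'I_p}) g q <= f X'.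
  exists (map_mx Num.floor X').
  have e i j : (Num.floor (X' i j))%:~R = X' i j.
    by apply/floorK; case: (hin (i, j)) => //; rewrite mem_enum.
  split=> [i j|]; first by rewrite mxE e; case: (hin (i, j)) => //; rewrite mem_enum.
  rewrite (_ : map_mx _ _ = X'); last by apply/matrixP=> i j; rewrite !mxE e.
  by move: hf; rewrite big_enum.
elim: (enum _) (enum_uniq {: 'I_m * 'I_p}) => [_|q s IH /= /andP[qs us]].
  by exists X; split=> //; split=> //; rewrite big_nil subr0.
have [X' [hin [hout hf]]] := IH us.
have [b fb] := fq X' q; set t := X' q.1 q.2.
(* The upper neighbour is floor t + 1 even when t is an integer; then d = 1, which the bound
   permits. *)
have [d [dint d1 bd]] : exists d, [/\ t + d \is a Num.int, `|d| <= 1 & 0 <= b * d].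
  have /andP[t0 t1] := floor_itv t; rewrite intrD in t1.
  have [b0|b0] := leP 0 b.
    exists ((Num.floor t)%:~R + 1 - t); split.
    - by rewrite addrC subrK rpredD ?rpred1 ?intr_int.
    - by rewrite ler_norml; lra.
    - by rewrite mulr_ge0//; lra.
  exists ((Num.floor t)%:~R - t); split.
  - by rewrite addrC subrK intr_int.
  - by rewrite ler_norml; lra.
  - by rewrite mulr_le0//; lra.
have ent r : (X' + d *: delta_mx q.1 q.2) r.1 r.2
    = if r == q then t + d else X' r.1 r.2.
  rewrite !mxE (_ : _ && _ = (r == q)); last by case: (r) (q) => ? ? [? ?].
  by case: eqVneq => [->|_]; rewrite ?mulr1 ?mulr0 ?addr0.
exists (X' + d *: delta_mx q.1 q.2); split; [|split].
- move=> r; rewrite inE ent; case: eqVneq => [-> _|_ /hin//].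
  by rewrite dint; split=> //; rewrite -(hout q)// -/t addrC addKr.
- by move=> r; rewrite inE ent negb_or => /andP[/negPf->] /hout.
- rewrite fb big_cons.
  have : g q * d ^+ 2 <= g q.
    by rewrite ler_piMr// -real_normK ?num_real// expr_le1.
  by lra.
Qed.

(** Indexes the basis e_i (x) e_a. An n x n matrix is thus a vector of the tensor product, and its
    rank is the Schmidt rank. *)
Definition idx (n : nat) : finType := ('I_n * 'I_n)%type.

Definition sqnorm (K : nzRingType) (m p : nat) (M : 'M[K]_(m, p)) : K :=
  \sum_q M q.1 q.2 ^+ 2.

Definition dotmat (K : nzRingType) (m p : nat) (M N : 'M[K]_(m, p)) : K :=
  \sum_q M q.1 q.2 * N q.1 q.2.

Definition tform (K : nzRingType) (n : nat) (G : idx n -> idx n -> K)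
    (M N : 'M[K]_n) : K :=
  \sum_(w : idx n * idx n) G w.1 w.2 * (M w.1.1 w.1.2 * N w.2.1 w.2.2).

Lemma sqnorm_ge0 (K : realDomainType) (m p : nat) (M : 'M[K]_(m, p)) : 0 <= sqnorm M.
Proof. by apply: sumr_ge0 => q _; exact: sqr_ge0. Qed.

Lemma sqnorm_eq0 (K : realDomainType) (m p : nat) (M : 'M[K]_(m, p)) :
  sqnorm M = 0 -> M = 0.
Proof.
move=> /eqP; rewrite psumr_eq0; last by move=> q _; exact: sqr_ge0.
move=> /allP h; apply/matrixP=> i j; rewrite mxE.
by have := h (i, j); rewrite mem_index_enum sqrf_eq0 /= => /(_ isT)/eqP.
Qed.

Lemma sqnormE (K : comNzRingType) (m p : nat) (M N : 'M[K]_(m, p)) (d : K) :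
  sqnorm (M + d *: N) = sqnorm M + 2 * dotmat M N * d + sqnorm N * d ^+ 2.
Proof.
rewrite /sqnorm /dotmat mulr_sumr !mulr_suml -!big_split; apply: eq_bigr => q _ /=.
by rewrite !mxE; ring.
Qed.

Lemma sqnorm_rows (K : nzRingType) (m p : nat) (M : 'M[K]_(m, p)) :
  sqnorm M = \sum_i \sum_j M i j ^+ 2.
Proof. by rewrite pair_big. Qed.

Lemma sqnormZ (K : comNzRingType) (m p : nat) (M : 'M[K]_(m, p)) (d : K) :
  sqnorm (d *: M) = d ^+ 2 * sqnorm M.
Proof. by rewrite mulr_sumr; apply: eq_bigr => q _; rewrite mxE exprMn. Qed.

Lemma tform_quad (K : comNzRingType) (n : nat) (G : idx n -> idx n -> K)
    (M N : 'M[K]_n) (d : K) :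
  tform G (M + d *: N) (M + d *: N)
    = tform G M M + (tform G M N + tform G N M) * d + tform G N N * d ^+ 2.
Proof.
rewrite /tform -big_split !mulr_suml -!big_split; apply: eq_bigr => w _ /=.
by rewrite !mxE; ring.
Qed.

Lemma tformZ (K : comNzRingType) (n : nat) (G : idx n -> idx n -> K)
    (M : 'M[K]_n) (d : K) : tform G (d *: M) (d *: M) = d ^+ 2 * tform G M M.
Proof. by rewrite mulr_sumr; apply: eq_bigr => w _; rewrite !mxE; ring. Qed.

Definition offdiag (K : nzRingType) (n : nat) (G : idx n -> idx n -> K) :=
  forall p q, (p.1 == q.1) || (p.2 == q.2) -> G p q = 0.

(** Changing one entry of X changes X Y in a single row, and G couples no two indices of the same
    row. *)
Lemma tform_row_supported (K : comNzRingType) (n : nat) (G : idx n -> idx n -> K)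
    (N : 'M[K]_n) i : offdiag G -> (forall j a, j != i -> N j a = 0) -> tform G N N = 0.
Proof.
move=> G0 N0; rewrite /tform big1// => -[p q] _ /=.
have [pi|/N0->] := eqVneq p.1 i; last by rewrite mul0r mulr0.
have [qi|/N0->] := eqVneq q.1 i; last by rewrite !mulr0.
by rewrite G0 ?mul0r// pi qi eqxx.
Qed.

Lemma tform_col_supported (K : comNzRingType) (n : nat) (G : idx n -> idx n -> K)
    (N : 'M[K]_n) i : offdiag G -> (forall j a, a != i -> N j a = 0) -> tform G N N = 0.
Proof.
move=> G0 N0; rewrite /tform big1// => -[p q] _ /=.
have [pi|/N0->] := eqVneq p.2 i; last by rewrite mul0r mulr0.
have [qi|/N0->] := eqVneq q.2 i; last by rewrite !mulr0.
by rewrite G0 ?mul0r// pi qi eqxx orbT.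
Qed.

Lemma delta_mulE (K : nzRingType) (n r p : nat) (i : 'I_n) (l : 'I_r) (Y : 'M[K]_(r, p)) j a :
  (delta_mx i l *m Y) j a = if j == i then Y l a else 0.
Proof.
rewrite mxE (bigD1 l)//= big1 => [|k /negPf kl]; rewrite !mxE ?eqxx ?andbT ?addr0.
  by case: eqP; rewrite ?mul1r ?mul0r.
by rewrite kl andbF mul0r.
Qed.

Lemma mul_deltaE (K : nzRingType) (n r p : nat) (l : 'I_r) (i : 'I_p) (X : 'M[K]_(n, r)) j a :
  (X *m delta_mx l i) j a = if a == i then X j l else 0.
Proof.
rewrite mxE (bigD1 l)//= big1 => [|k /negPf kl]; rewrite !mxE ?eqxx ?addr0.
  by case: eqP; rewrite ?mulr1 ?mulr0.
by rewrite kl mulr0.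
Qed.

(* Along a matrix unit in either factor the form has no quadratic term, since
   G is off-diagonal, so only the penalty T * sqnorm contributes one. *)
Lemma round_factors (K : archiRealFieldType) (n r : nat) (G : idx n -> idx n -> K)
    (s T : K) (X : 'M[K]_(n, r)) (Y : 'M[K]_(r, n)) :
  offdiag G -> 0 <= T ->
  let F M := s * tform G M M - T * sqnorm M in
  exists (ZX : 'M[int]_(n, r)) (ZY : 'M[int]_(r, n)),
  [/\ (forall i j, `|(ZX i j)%:~R - X i j| <= 1),
      (forall i j, `|(ZY i j)%:~R - Y i j| <= 1) &
      F (X *m Y) - T * n%:R * (sqnorm Y + sqnorm (map_mx intr ZX : 'M[K]_(n, r)))
        <= F (map_mx intr ZX *m map_mx intr ZY)].
Proof.
move=> G0 T0 F.
have FE M N : tform G N N = 0 -> exists b,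
    forall d, F (M + d *: N) = F M + b * d - T * sqnorm N * d ^+ 2.
  move=> N0; exists (s * (tform G M N + tform G N M) - T * (2 * dotmat M N)) => e.
  by rewrite /F tform_quad sqnormE N0; ring.
have [||ZX [ZX1 ZX2]] := @integer_rounding K n r (fun X => F (X *m Y))
  (fun q => T * \sum_a Y q.2 a ^+ 2) _ _ X.
- by move=> q; rewrite mulr_ge0// sumr_ge0// => a _; exact: sqr_ge0.
- move=> X' [i l] /=.
  have [|b hb] := FE (X' *m Y) (delta_mx i l *m Y).
    by apply: (tform_row_supported (i := i)) => // j a /negPf ji; rewrite delta_mulE ji.
  exists b => d; rewrite mulmxDl -scalemxAl hb; congr (_ - T * _ * _).
  rewrite sqnorm_rows (bigD1 i)//= [X in _ + X]big1 ?addr0 => [|j /negPf ji].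
    by apply: eq_bigr => a _; rewrite delta_mulE eqxx.
  by rewrite big1// => a _; rewrite delta_mulE ji expr0n.
(* Y is rounded against the already rounded left factor, so this cost involves the columns of [ZX]
   and not those of X. *)
have [||ZY [ZY1 ZY2]] := @integer_rounding K r n (fun Y => F (map_mx intr ZX *m Y))
  (fun q => T * \sum_i (ZX i q.1)%:~R ^+ 2) _ _ Y.
- by move=> q; rewrite mulr_ge0// sumr_ge0// => a _; exact: sqr_ge0.
- move=> Y' [l i] /=.
  have [|b hb] := FE (map_mx intr ZX *m Y') (map_mx intr ZX *m delta_mx l i).
    by apply: (tform_col_supported (i := i)) => // j a /negPf ji; rewrite mul_deltaE ji.
  exists b => d; rewrite mulmxDr -scalemxAr hb; congr (_ - T * _ * _).
  rewrite sqnorm_rows; apply: eq_bigr => j _.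
  rewrite (bigD1 i)//= [X in _ + X]big1 ?addr0 => [|a /negPf ai].
    by rewrite mul_deltaE eqxx mxE.
  by rewrite mul_deltaE ai expr0n.
exists ZX, ZY; split=> //; apply: le_trans ZY2.
have e1 : \sum_(q : 'I_n * 'I_r) T * (\sum_a Y q.2 a ^+ 2) = T * n%:R * sqnorm Y.
  rewrite -mulr_sumr -(pair_big predT predT (fun (i : 'I_n) l => \sum_a Y l a ^+ 2)) /=.
  by rewrite sumr_const card_ord -sqnorm_rows -mulrA [in RHS]mulr_natl.
have e2 : \sum_(q : 'I_r * 'I_n) T * (\sum_i (ZX i q.1)%:~R ^+ 2)
    = T * n%:R * sqnorm (map_mx intr ZX : 'M[K]_(n, r)).
  rewrite -mulr_sumr.
  rewrite -(pair_big predT predT (fun l (i : 'I_n) => \sum_i (ZX i l)%:~R ^+ 2)) /=.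
  under eq_bigr do rewrite sumr_const card_ord.
  rewrite sumrMnl -mulrA [in RHS]mulr_natl; congr (_ * (_ *+ _)).
  rewrite exchange_big sqnorm_rows; apply: eq_bigr => i _.
  by apply: eq_bigr => l _; rewrite mxE.
by move: ZX2; rewrite e1 e2; lra.
Qed.

(** * Random sign forms *)

Lemma sqnorm_trace (K : comNzRingType) (m p : nat) (M : 'M[K]_(m, p)) :
  sqnorm M = \tr (M^T *m M).
Proof.
rewrite sqnorm_rows exchange_big; apply: eq_bigr => j _.
by rewrite mxE; apply: eq_bigr => i _; rewrite !mxE expr2.
Qed.

(* Gram-Schmidt; a vanishing residual w gives a zero column, as 0^-1 = 0. *)
Lemma column_partial_isometry (K : rcfType) (n r : nat) (A : 'M[K]_(n, r)) :
  exists X : 'M[K]_(n, r),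
    [/\ X *m X^T *m X = X, X *m X^T *m A = A & sqnorm X <= r%:R].
Proof.
elim: r A => [A|r IH].
  by exists A; rewrite !thinmx0 /sqnorm big1 ?lexx// => -[? []].
change r.+1 with (1 + r)%N => A.
pose a := lsubmx A; pose A0 := rsubmx A.
have [X0 [h1 h2 h3]] := IH A0.
pose w := a - X0 *m X0^T *m a.
have X0w : X0^T *m w = 0.
  rewrite mulmxBr; apply/eqP; rewrite subr_eq0; apply/eqP.
  have := congr1 trmx h1; rewrite !trmx_mul trmxK => e.
  by rewrite -[in LHS]e !mulmxA.
have wwE : w^T *m w = (sqnorm w)%:M.
  by rewrite [LHS]mx11_scalar sqnorm_trace /mxtrace big_ord1.
pose u := (Num.sqrt (sqnorm w))^-1 *: w.
have X0u : X0^T *m u = 0 by rewrite -scalemxAr X0w scaler0.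
have uX0 : u^T *m X0 = 0 by rewrite -[X0]trmxK -trmx_mul X0u trmx0.
have s2 : Num.sqrt (sqnorm w) ^+ 2 = sqnorm w by rewrite sqr_sqrtr ?sqnorm_ge0.
have uw : u *m u^T *m w = w.
  rewrite -mulmxA linearZ /= -scalemxAl wwE -scalemxAl -scalemxAr mul_mx_scalar.
  have [s0|s0] := eqVneq (sqnorm w) 0; first by rewrite (sqnorm_eq0 s0) !scaler0.
  have : Num.sqrt (sqnorm w) != 0 by rewrite sqrtr_eq0 -ltNge lt_def s0 sqnorm_ge0.
  rewrite !scalerA; move: s2; set t := Num.sqrt _ => <- t0.
  by rewrite -[RHS]scale1r; congr (_ *: _); field.
have uu : u *m u^T *m u = u by rewrite {3}/u -scalemxAr uw.
have ua : u *m u^T *m a = w.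
  rewrite -[in RHS]uw /w mulmxBr -!mulmxA [u^T *m (X0 *m _)]mulmxA uX0.
  by rewrite mul0mx mulmx0 subr0.
have uA0 : u *m u^T *m A0 = 0.
  by rewrite -h2 -!mulmxA [u^T *m (X0 *m _)]mulmxA uX0 mul0mx mulmx0.
have XX : row_mx u X0 *m (row_mx u X0)^T = u *m u^T + X0 *m X0^T.
  by rewrite tr_row_mx mul_row_col.
exists (row_mx u X0); rewrite XX; split.
- rewrite mul_mx_row !mulmxDl uu h1 -!mulmxA X0u uX0 !mulmx0.
  by rewrite addr0 add0r.
- rewrite -[A]hsubmxK -/a -/A0 mul_mx_row !mulmxDl ua uA0 h2 add0r.
  by congr (row_mx _ _); rewrite /w subrK.
- rewrite sqnorm_trace mxtrace_mulC XX raddfD /= mxtrace_mulC -sqnorm_trace.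
  rewrite [X in _ + X]mxtrace_mulC -sqnorm_trace natrD lerD//.
  rewrite sqnormZ exprVn s2.
  by have [->|s0] := eqVneq (sqnorm w) 0; rewrite ?mulr0// mulVf.
Qed.

(** Ordering by the first index picks one independent sign for each unordered pair of indices
    differing in both components; [signG] symmetrizes. *)
Definition upsign (K : realType) (n : nat) (e : {ffun idx n * idx n -> bool})
    (p q : idx n) : K :=
  if (p.1 < q.1)%N && (p.2 != q.2) then sgn K (e (p, q)) else 0.

Definition signG (K : realType) (n : nat) (e : {ffun idx n * idx n -> bool})
    (p q : idx n) : K := upsign K e p q + upsign K e q p.

Lemma signGC (K : realType) (n : nat) (e : {ffun idx n * idx n -> bool}) p q :
  signG K e p q = signG K e q p.
Proof. exact: addrC. Qed.

Lemma signG_offdiag (K : realType) (n : nat) (e : {ffun idx n * idx n -> bool}) :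
  offdiag (signG K e).
Proof.
by move=> p q; rewrite /signG /upsign [q.2 == _]eq_sym => /orP[/eqP->|/eqP->];
  rewrite ?ltnn ?eqxx ?andbF addr0.
Qed.

Lemma signG_sqr (K : realType) (n : nat) (e : {ffun idx n * idx n -> bool}) p q :
  signG K e p q ^+ 2 = ((p.1 != q.1) && (p.2 != q.2))%:R.
Proof.
have [e2|n2] := eqVneq p.2 q.2.
  by rewrite signG_offdiag ?andbF ?expr0n// e2 eqxx orbT.
rewrite /signG /upsign [q.2 == _]eq_sym n2 !andbT.
by rewrite -val_eqE /sgn; case: ltngtP => _;
  rewrite ?addr0 ?add0r ?expr0n ?sqrr_sign.
Qed.

Definition upprod (K : realType) (n : nat) (M : 'M[K]_n) (w : idx n * idx n) : K :=
  if (w.1.1 < w.2.1)%N && (w.1.2 != w.2.2) then M w.1.1 w.1.2 * M w.2.1 w.2.2 else 0.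

Lemma tform_signG (K : realType) (n : nat) (e : {ffun idx n * idx n -> bool})
    (M : 'M[K]_n) :
  tform (signG K e) M M = \sum_w sgn K (e w) * (2 * upprod M w).
Proof.
have eq1 : \sum_(w : idx n * idx n) upsign K e w.1 w.2 * (M w.1.1 w.1.2 * M w.2.1 w.2.2)
   = \sum_w sgn K (e w) * upprod M w.
  apply: eq_bigr => -[p q] _; rewrite /upsign /upprod /=.
  by case: ifP; rewrite ?mul0r ?mulr0.
rewrite /tform; under eq_bigr do rewrite mulrDl.
rewrite big_split /= eq1 [X in _ + X](_ : _ = \sum_w sgn K (e w) * upprod M w).
  by rewrite -big_split; apply: eq_bigr => w _ /=; ring.
rewrite -eq1 (reindex_inj (h := fun w => (w.2, w.1))) /=; last first.
  by move=> [? ?] [? ?] [-> ->].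
by apply: eq_bigr => w _; rewrite [M _ _ * _]mulrC.
Qed.

(* If M = 0 the quotient is 0, as x / 0 = 0. *)
Lemma sum_expR_tform (K : realType) (n : nat) (M : 'M[K]_n) (u : K) :
  \sum_(e : {ffun idx n * idx n -> bool}) expR (u * (tform (signG K e) M M / sqnorm M))
    <= 2 ^+ #|{: idx n * idx n}| * expR (8 * u ^+ 2).
Proof.
pose c w := 2 * upprod M w * (u / sqnorm M).
have -> : \sum_(e : {ffun idx n * idx n -> bool})
    expR (u * (tform (signG K e) M M / sqnorm M))
  = \sum_(e : {ffun idx n * idx n -> bool}) expR (\sum_w sgn K (e w) * c w).
  apply: eq_bigr => e _; rewrite tform_signG; congr expR.
  by rewrite mulr_suml mulr_sumr; apply: eq_bigr => w _; rewrite /c; ring.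
apply: le_trans (sum_expR_signs c) _; rewrite ler_pM2l ?exprn_gt0// ler_expR.
(* The products M_p M_q over all pairs have square sum |M|^4. The factor 2 from [sum_expR_signs]
   turns 4 u^2 into 8 u^2. *)
suff : \sum_w c w ^+ 2 <= 4 * u ^+ 2 by lra.
have [s0|s0] := eqVneq (sqnorm M) 0.
  rewrite big1; first by have := sqr_ge0 u; lra.
  by move=> w _; rewrite /c s0 invr0 !mulr0 expr0n.
have -> : \sum_w c w ^+ 2 = 4 * u ^+ 2 / sqnorm M ^+ 2 * \sum_w upprod M w ^+ 2.
  by rewrite mulr_sumr; apply: eq_bigr => w _; rewrite /c; field.
rewrite -mulrA ler_piMr ?(mulr_ge0 _ (sqr_ge0 u))//.
rewrite mulrC ler_pdivrMr ?mul1r; last first.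
  by rewrite lt_def sqr_ge0 andbT expf_eq0.
apply: le_trans (_ : \sum_(w : idx n * idx n) M w.1.1 w.1.2 ^+ 2 * M w.2.1 w.2.2 ^+ 2 <= _).
  apply: ler_sum => w _; rewrite /upprod -exprMn; case: ifP => // _.
  by rewrite expr0n sqr_ge0.
rewrite expr2 /sqnorm mulr_suml.
under [leRHS]eq_bigr do rewrite mulr_sumr.
by rewrite pair_big.
Qed.

(** * Union bound over pairs of integer factors *)

Definition net_mx (m p Q : nat) (z : net ('I_m * 'I_p)%type Q) : 'M[int]_(m, p) :=
  \matrix_(i, j) ((-1) ^+ (z (i, j)).1 * (z (i, j)).2%:Z).

Lemma net_mx_surj (m p Q : nat) (Z : 'M[int]_(m, p)) :
  sqnorm Z <= Q%:Z ->
  exists z : net ('I_m * 'I_p)%type Q,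
    (\sum_q (z q).2 ^ 2 <= Q)%N /\ net_mx z = Z.
Proof.
move=> hZ.
have hs : (\sum_(q : 'I_m * 'I_p) `|Z q.1 q.2| ^ 2 <= Q)%N.
  rewrite -lez_nat; apply: le_trans hZ; rewrite -[leLHS]natz natr_sum /sqnorm.
  apply: ler_sum => q _.
  by rewrite natrX natz abszE real_normK ?num_real.
(* The absolute value of an integer is at most its square, so each entry fits the range of the
   code. *)
have hq q : (`|Z q.1 q.2| < Q.+1)%N.
  rewrite ltnS; apply: leq_trans hs; rewrite (bigD1 q)//=.
  apply: leq_trans (leq_addr _ _).
  by case: `|Z q.1 q.2|%N => // a; rewrite expnS leq_pmulr// expn_gt0.
exists [ffun q => (Z q.1 q.2 < 0, Ordinal (hq q))]; split.
  by under eq_bigr do rewrite ffunE.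
by apply/matrixP=> i j; rewrite mxE ffunE /= -intEsign.
Qed.

Lemma sqnorm_round (K : realDomainType) (m p : nat) (X : 'M[K]_(m, p)) (Z : 'M[int]_(m, p)) :
  (forall i j, `|(Z i j)%:~R - X i j| <= 1) ->
  sqnorm (map_mx intr Z : 'M[K]_(m, p)) <= 2 * sqnorm X + 2 * (m * p)%:R.
Proof.
move=> h; have -> : (m * p)%:R = \sum_(q : 'I_m * 'I_p) (1 : K).
  by rewrite sumr_const card_prod !card_ord.
rewrite !mulr_sumr -big_split; apply: ler_sum => q _ /=; rewrite mxE.
have : (((Z q.1 q.2)%:~R - X q.1 q.2) ^+ 2 <= 1 :> K).
  by rewrite -real_normK ?num_real// expr_le1.
(* With z and x the two entries, this square equals 2 x^2 + 2 (z - x)^2 - z^2. *)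
have := sqr_ge0 ((Z q.1 q.2)%:~R - 2 * X q.1 q.2).
by nra.
Qed.

Definition netprod (K : realType) (n r Q : nat)
    (z : net ('I_n * 'I_r)%type Q * net ('I_r * 'I_n)%type Q) : 'M[K]_n :=
  map_mx intr (net_mx z.1) *m map_mx intr (net_mx z.2).

Definition netset (n r Q : nat) :
    {set net ('I_n * 'I_r)%type Q * net ('I_r * 'I_n)%type Q} :=
  finset.setX [set z : net _ Q | (\sum_q (z q).2 ^ 2 <= Q)%N]
    [set z : net _ Q | (\sum_q (z q).2 ^ 2 <= Q)%N].

(** The union bound in exponential form. For u > 0, a net pair violating |tform| <= T * sqnorm makes
    one of its two terms exceed 1, so a value below 1 excludes every violation, while the sum over
    [e] is controlled by the moment bound. *)
Definition badness (K : realType) (n r Q : nat) (u T : K)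
    (e : {ffun idx n * idx n -> bool}) : K :=
  \sum_(z in netset n r Q) \sum_(b : bool)
    expR ((sgn K b * u) * (tform (signG K e) (netprod K z) (netprod K z) / sqnorm (netprod K z))
          - u * T).

Lemma badness_ge0 (K : realType) (n r Q : nat) (u T : K) e :
  0 <= badness (n := n) r Q u T e.
Proof. by do 2![apply: sumr_ge0 => ? _]; exact: expR_ge0. Qed.

Lemma badness_lt1 (K : realType) (n r Q : nat) (u T : K) e
    (ZX : 'M[int]_(n, r)) (ZY : 'M[int]_(r, n)) :
  0 < u -> badness r Q u T e < 1 -> sqnorm ZX <= Q%:Z -> sqnorm ZY <= Q%:Z ->
  forall M : 'M[K]_n, M = map_mx intr ZX *m map_mx intr ZY ->
  `|tform (signG K e) M M| <= T * sqnorm M.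
Proof.
move=> u0 blt /net_mx_surj[zx [hx dx]] /net_mx_surj[zy [hy dy]] M eM.
have [s0|s0] := eqVneq (sqnorm M) 0.
  rewrite (sqnorm_eq0 s0) /tform big1; first by rewrite -(sqnorm_eq0 s0) s0 normr0 mulr0.
  by move=> w _; rewrite mxE !mul0r mulr0.
have sp : 0 < sqnorm M by rewrite lt_def s0 sqnorm_ge0.
pose z := (zx, zy).
have ME : M = netprod K z by rewrite eM -dx -dy.
have zin : z \in netset n r Q by rewrite !inE /= hx hy.
have hb b : sgn K b * tform (signG K e) M M <= T * sqnorm M.
  have : expR ((sgn K b * u) * (tform (signG K e) M M / sqnorm M) - u * T) < 1.
    apply: le_lt_trans blt; rewrite /badness (bigD1 z)//= (bigD1 b)//= -ME -addrA lerDl.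
    apply: addr_ge0; apply: sumr_ge0 => *; first exact: expR_ge0.
    by apply: sumr_ge0 => *; exact: expR_ge0.
  rewrite expR_lt1 => h.
  rewrite -ler_pdivrMr// -(ler_pM2l u0) -subr_le0; apply: ltW; apply: le_lt_trans h.
  by rewrite le_eqVlt; apply/orP; left; apply/eqP; field.
rewrite ler_norml; have := hb true; have := hb false.
by rewrite /sgn expr0 expr1; lra.
Qed.

Lemma sum_badness (K : realType) (n r Q : nat) (u T : K) :
  \sum_e badness (n := n) r Q u T e
    <= 2 ^+ #|{: idx n * idx n}| *
       ((2 ^+ Q * 4 ^+ (n * r)) ^+ 2 * (2 * expR (8 * u ^+ 2 - u * T))).
Proof.
rewrite exchange_big /=.
apply: (@le_trans _ _ (\sum_(z in netset n r Q)
   (2 ^+ #|{: idx n * idx n}| * (2 * expR (8 * u ^+ 2 - u * T))))).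
  apply: ler_sum => z _; rewrite exchange_big big_bool /=.
  have h v : v ^+ 2 = u ^+ 2 -> \sum_(e : {ffun idx n * idx n -> bool})
     expR (v * (tform (signG K e) (netprod K z) (netprod K z) / sqnorm (netprod K z)) - u * T)
       <= 2 ^+ #|{: idx n * idx n}| * expR (8 * u ^+ 2 - u * T).
    move=> vu; under eq_bigr do rewrite expRD.
    rewrite -mulr_suml expRD mulrA ler_pM2r ?expR_gt0// -vu.
    exact: sum_expR_tform.
  apply: le_trans (lerD (h (sgn K true * u) _) (h (sgn K false * u) _)) _.
  - by rewrite /sgn; ring.
  - by rewrite /sgn; ring.
  - by rewrite le_eqVlt; apply/orP; left; apply/eqP; ring.
rewrite sumr_const -[leLHS]mulr_natl [leLHS]mulrCA ler_pM2l ?exprn_gt0//.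
rewrite ler_pM2r ?mulr_gt0 ?expR_gt0//.
rewrite cardsX natrM expr2; apply: ler_pM; rewrite ?ler0n//.
  by apply: le_trans (card_net K _ _) _; rewrite card_prod !card_ord.
by apply: le_trans (card_net K _ _) _; rewrite card_prod !card_ord mulnC.
Qed.

Lemma expR_natl_ge (K : realType) (N : nat) : 2 ^+ N <= expR N%:R :> K.
Proof.
rewrite -[N%:R]mulr1 expRM_natl; apply: lerXn2r; rewrite ?nnegrE ?expR_ge0//.
by have := expR_ge1Dx (1 : K); lra.
Qed.

(** With D = r n the exponent is 8 u^2 - 16 u^2 = -32 D, against at most 2^(12 D + 1) terms from two
    nets and two signs. As e >= 2, a factor 1/4 is left to spare. *)
Lemma mean_badness (K : realType) (n r : nat) : (0 < r * n)%N ->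
  forall u : K, u = 2 * Num.sqrt (r * n)%:R ->
  \sum_e badness (n := n) r (4 * (r * n)) u (16 * u) e
    <= 2 ^+ #|{: idx n * idx n}| / 4.
Proof.
move=> D0 u uE; apply: le_trans (sum_badness _ _ _ _ _) _.
rewrite ler_pM2l ?exprn_gt0// [(n * r)%N]mulnC.
move: (r * n)%N D0 uE => D D0 uE.
have u2 : u ^+ 2 = 4 * D%:R by rewrite uE exprMn sqr_sqrtr ?ler0n//; ring.
have -> : 8 * u ^+ 2 - u * (16 * u) = - (32 * D)%:R.
  by rewrite (_ : 8 * _ - _ = - 8 * u ^+ 2); [rewrite u2 natrM|]; ring.
have -> : (4 : K) = 2 ^+ 2 by ring.
rewrite -!exprM -!exprD expRN -!exprM mulrA -exprSr ler_pdivrMr ?expR_gt0//.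
apply: le_trans (_ : 2 ^- 2 * 2 ^+ (32 * D) <= _); last first.
  by rewrite ler_pM2l ?invr_gt0 ?exprn_gt0// expR_natl_ge.
rewrite ler_pdivlMl ?exprn_gt0// -exprD ler_eXn2l ?ltr1n//.
by lia.
Qed.

(** First moment argument: otherwise f + g >= 1 everywhere, so the two sums would total at least |I|
    instead of |I| / 2. *)
Lemma exists_small_sum (K : realFieldType) (I : finType) (f g : I -> K) :
  (forall i, 0 <= f i) -> (forall i, 0 <= g i) -> (0 < #|I|)%N ->
  \sum_i f i <= #|I|%:R / 4 -> \sum_i g i <= #|I|%:R / 4 ->
  exists i, f i < 1 /\ g i < 1.
Proof.
move=> f0 g0 I0 hf hg; apply: contrapT => /forallNP h.
have : \sum_(i : I) 1 <= \sum_i (f i + g i).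
  apply: ler_sum => i _; have := f0 i; have := g0 i.
  have [f1|f1] := ltP (f i) 1; last by lra.
  have [g1|g1] := ltP (g i) 1; last by lra.
  by have := h i; rewrite f1 g1 => -[].
rewrite big_split sumr_const /=.
have : 0 < #|I|%:R :> K by rewrite ltr0n.
by lra.
Qed.

(** A multiple d M is factored so that each factor has squared norm at most r n, its number of
    entries. Rounding then raises this to at most 4 r n, and the integer factors lie in the net. *)
Lemma factor_bound (K : realType) (n r : nat) (e : {ffun idx n * idx n -> bool}) :
  (0 < r * n)%N ->
  let u : K := 2 * Num.sqrt (r * n)%:R in
  badness r (4 * (r * n)) u (16 * u) e < 1 ->
  forall (A : 'M[K]_(n, r)) (B : 'M[K]_(r, n)),
  `|tform (signG K e) (A *m B) (A *m B)|
    <= 192 * Num.sqrt (r * n)%:R * sqnorm (A *m B).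
Proof.
move=> D0 u blt A B; set M := A *m B.
have D0' : 0 < (r * n)%:R :> K by rewrite ltr0n.
have u0 : 0 < u by rewrite /u mulr_gt0// sqrtr_gt0.
have [s0|s0] := eqVneq (sqnorm M) 0.
  rewrite (sqnorm_eq0 s0) /tform big1; first by rewrite -(sqnorm_eq0 s0) s0 normr0 mulr0.
  by move=> w _; rewrite mxE !mul0r mulr0.
have sp : 0 < sqnorm M by rewrite lt_def s0 sqnorm_ge0.
have n0 : 0 < n%:R :> K by move: D0; rewrite muln_gt0 ltr0n => /andP[].
have [X [X1 X2 X3]] := column_partial_isometry A.
(* Makes |d M|^2 = r n * n; X takes the scale sqrt n and X^T M the rest. *)
pose d := Num.sqrt ((r * n)%:R * n%:R / sqnorm M).
have d2 : d ^+ 2 * sqnorm M = (r * n)%:R * n%:R.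
  by rewrite sqr_sqrtr ?divfK// divr_ge0 ?mulr_ge0 ?ler0n// ltW.
have d20 : 0 < d ^+ 2 by rewrite exprn_gt0// sqrtr_gt0 divr_gt0// mulr_gt0.
pose t := Num.sqrt (n%:R : K).
have t2 : t ^+ 2 = n%:R by rewrite sqr_sqrtr ?ler0n.
have t0 : t != 0 by rewrite lt0r_neq0// sqrtr_gt0.
pose X' := t *: X; pose Y' := (d / t) *: (X^T *m M).
have XYE : X' *m Y' = d *: M.
  rewrite /X' /Y' -scalemxAl -scalemxAr scalerA mulmxA.
  have -> : X *m X^T *m M = M by rewrite /M mulmxA X2.
  by congr (_ *: _); field.
have sX : sqnorm X' <= (r * n)%:R.
  by rewrite sqnormZ t2 natrM mulrC ler_pM2r.
have sY : sqnorm Y' = (r * n)%:R.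
  rewrite sqnormZ (_ : sqnorm (X^T *m M) = sqnorm M); last first.
    rewrite [LHS]sqnorm_trace trmx_mul trmxK -mulmxA [X *m (X^T *m M)]mulmxA /M.
    by rewrite [X *m X^T *m (A *m B)]mulmxA X2 -sqnorm_trace.
  by rewrite exprMn exprVn mulrAC d2 t2 mulfK// lt0r_neq0.
have T0 : 0 <= 16 * u by rewrite mulr_ge0// ltW.
(* Put T = 16 u. The penalized form is nonpositive at the rounded product, and rounding costs at
   most T n * 5 r n = 5 T |d M|^2; the penalty itself adds T |d M|^2. Finally 6 * 16 * 2 = 192. *)
have hs b : sgn K b * tform (signG K e) (d *: M) (d *: M) <= 6 * (16 * u) * sqnorm (d *: M).
  have [ZX [ZY [hX hY]]] := @round_factors K n r (signG K e) (sgn K b) (16 * u) X' Y'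
     (@signG_offdiag K n e) T0.
  have zx := sqnorm_round hX; have zy := sqnorm_round hY.
  have sZ (m p : nat) (Z : 'M[int]_(m, p)) (N : nat) :
     sqnorm (map_mx intr Z : 'M[K]_(m, p)) <= N%:R -> sqnorm Z <= N%:Z.
    rewrite -[N%:R]/((N%:Z)%:~R) -(@ler_int K); congr (_ <= _).
    rewrite /sqnorm rmorph_sum; apply: eq_bigr => q _.
    by rewrite mxE rmorphXn.
  have zx4 : sqnorm (map_mx intr ZX : 'M[K]_(n, r)) <= (4 * (r * n))%:R.
    by rewrite natrM; move: zx; rewrite mulnC; lra.
  have zy4 : sqnorm (map_mx intr ZY : 'M[K]_(r, n)) <= (4 * (r * n))%:R.
    by rewrite natrM; move: zy; rewrite sY; lra.
  have := badness_lt1 u0 blt (sZ _ _ _ _ zx4) (sZ _ _ _ _ zy4) erefl.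
  set N := _ *m map_mx intr ZY => hN.
  have hN' : sgn K b * tform (signG K e) N N <= 16 * u * sqnorm N.
    apply: le_trans hN; apply: le_trans (ler_norm _) _.
    by rewrite normrM /sgn normrX normrN1 expr1n mul1r.
  rewrite XYE sY sqnormZ d2 => h.
  have : 16 * u * n%:R * ((r * n)%:R + sqnorm (map_mx intr ZX : 'M[K]_(n, r)))
     <= 16 * u * n%:R * (5 * (r * n)%:R).
    rewrite ler_wpM2l//; first by rewrite mulr_ge0// ler0n.
    by move: zx4; rewrite [(4 * _)%:R]natrM; lra.
  by move: h hN'; lra.
have h1 := hs true; have h2 := hs false.
rewrite !tformZ sqnormZ /sgn expr1 expr0 in h1 h2.
rewrite -(ler_pM2l d20) -[leLHS]ger0_norm; last by rewrite mulr_ge0// ltW.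
rewrite normrM normr_id -normrM ler_norml.
by move: h1 h2; rewrite /u; lra.
Qed.

(* r1 = 2k controls k-positivity and r2 = n the operator norm. *)
Lemma exists_signs (K : realType) (n r1 r2 : nat) :
  (0 < r1 * n)%N -> (0 < r2 * n)%N ->
  exists e : {ffun idx n * idx n -> bool},
    forall r, (r == r1) || (r == r2) ->
    forall (A : 'M[K]_(n, r)) (B : 'M[K]_(r, n)),
    `|tform (signG K e) (A *m B) (A *m B)|
      <= 192 * Num.sqrt (r * n)%:R * sqnorm (A *m B).
Proof.
move=> h1 h2.
pose f r e : K := badness (n := n) r (4 * (r * n))
  (2 * Num.sqrt (r * n)%:R) (16 * (2 * Num.sqrt (r * n)%:R)) e.
have card : #|{: {ffun idx n * idx n -> bool}}|%:R = 2 ^+ #|{: idx n * idx n}| :> K.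
  by rewrite card_ffun card_bool natrX.
have [||||| e [e1 e2]] := @exists_small_sum K {ffun idx n * idx n -> bool} (f r1) (f r2).
- by move=> e; exact: badness_ge0.
- by move=> e; exact: badness_ge0.
- by rewrite card_ffun card_bool expn_gt0.
- by rewrite card; exact: mean_badness.
- by rewrite card; exact: mean_badness.
by exists e => r /orP[]/eqP-> A B; exact: factor_bound.
Qed.

(** * k-positivity *)

Local Open Scope complex_scope.

Lemma Re_sum (I : finType) (F : I -> C) : complex.Re (\sum_i F i) = \sum_i complex.Re (F i).
Proof. exact: raddf_sum. Qed.

Lemma Im_sum (I : finType) (F : I -> C) : complex.Im (\sum_i F i) = \sum_i complex.Im (F i).
Proof. exact: raddf_sum. Qed.

Lemma delta_sandwich (K : pzRingType) (n : nat) (A : 'M[K]_n) p q :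
  ((delta_mx 0 p : 'rV[K]_n) *m A *m (delta_mx q 0 : 'cV_n)) 0 0 = A p q.
Proof. by rewrite -rowE -colE !mxE. Qed.

(** Polarization: the form is real at e_i + c e_j. The choice c = 0 makes the diagonal real; c = 1
    and c = i then compare the imaginary and real parts of [A i j] and [A j i]. *)
Lemma psd_hermitian (p : nat) (A : 'M[C]_p) : psd A -> A = map_mx conjc A^T.
Proof.
move=> A0; apply/matrixP=> i j; rewrite !mxE.
have h i' j' (c : C) : complex.Im (A i' i' + c^* * c * A j' j' + c * A i' j' + c^* * A j' i') = 0.
  pose v : 'cV[C]_p := delta_mx i' 0 + c *: delta_mx j' 0.
  have vE : (map_mx conjc v)^T = delta_mx 0 i' + c^* *: delta_mx 0 j'.
    apply/matrixP=> x y; rewrite !mxE rmorphD rmorphM /= !conjc_nat.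
    by rewrite [x]ord1 !eqxx !andbT.
  have := ger0_Im (A0 v); rewrite vE !mulmxDl !mulmxDr -!scalemxAl -!scalemxAr => <-.
  congr complex.Im; rewrite ![(_ + _ : 'M_1) 0 0]mxE ![(_ *: _ : 'M_1) 0 0]mxE.
  by rewrite !delta_sandwich; ring.
have := h j i (0 +i* 0); have := h i j (0 +i* 0).
have := h i j (1 +i* 0); have := h i j (0 +i* 1).
case: (A i j) (A j i) (A i i) (A j j) => [a b] [a' b'] [a1 b1] [a2 b2].
rewrite /= => h1 h2 h3 h4; apply/eqP; rewrite eq_complex /=.
by apply/andP; split; apply/eqP; lra.
Qed.

(** Reduces positivity of an amplification to rank one inputs. Each eigenvalue is the value of the
    form at its unit eigenvector, hence nonnegative. *)
Lemma psd_spectral (p : nat) (A : 'M[C]_p) : psd A ->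
  exists (P : 'M[C]_p) (d : 'I_p -> C), (forall s, 0 <= d s) /\
    forall i j, A i j = \sum_s d s * ((P s i)^* * P s j).
Proof.
move=> A0.
have /orthomx_spectralP : A \is normalmx.
  apply: hermitian_normalmx; apply/is_hermitianmxP.
  by rewrite expr0 scale1r; exact: psd_hermitian.
set P := spectralmx A; set sp := spectral_diag A.
have Pu : P \is unitarymx := spectral_unitarymx A.
rewrite invmx_unitary// => AE.
exists P, (fun s => sp 0 s); split=> [s|i j].
  have := A0 (map_mx conjc P^T *m delta_mx s 0).
  have -> : (map_mx conjc (map_mx conjc P^T *m (delta_mx s 0 : 'cV_p)))^T = delta_mx 0 s *m P.
    rewrite map_mxM /= trmx_mul; congr (_ *m _).
      by apply/matrixP=> x y; rewrite !mxE conjc_nat andbC.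
    by apply/matrixP=> x y; rewrite !mxE conjcK.
  rewrite -!mulmxA [P *m _]mulmxA [_ *m (map_mx _ _ *m _)]mulmxA mulmxA.
  rewrite delta_sandwich {1}AE => h.
  have PP : P *m map_mx conjc P^T = 1%:M by exact/unitarymxP.
  have PAP : P *m (map_mx conjc P^T *m diag_mx sp *m P) *m map_mx conjc P^T = diag_mx sp.
    by rewrite !mulmxA PP mul1mx -mulmxA PP mulmx1.
  move: h; rewrite -[map_mx Num.conj_op _]/(map_mx conjc P^T) PAP.
  by rewrite mxE eqxx.
rewrite {1}AE -mulmxA mxE; apply: eq_bigr => s _.
by rewrite mul_diag_mx !mxE mulrCA.
Qed.

Definition hform (n : nat) (W : idx n -> idx n -> R) (M : 'M[C]_n) : C :=
  \sum_(w : idx n * idx n)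
    (W w.1 w.2)%:C * ((M w.1.1 w.1.2)^* * M w.2.1 w.2.2).

(** Cross terms between real and imaginary parts of M enter only the imaginary part, where they
    cancel by symmetry of W. *)
Lemma hformE (n : nat) (W : idx n -> idx n -> R) (M : 'M[C]_n) :
  (forall p q, W p q = W q p) ->
  hform W M = (tform W (map_mx (@complex.Re R) M) (map_mx (@complex.Re R) M)
    + tform W (map_mx (@complex.Im R) M) (map_mx (@complex.Im R) M))%:C.
Proof.
move=> Wsym; apply/eqP; rewrite eq_complex; apply/andP; split; apply/eqP.
  rewrite Re_sum /= /tform -big_split; apply: eq_bigr => w _ /=; rewrite !mxE.
  by case: (M _ _) (M _ _) => [a b] [a' b'] /=; ring.
rewrite Im_sum /=.
pose S := \sum_(w : idx n * idx n) W w.1 w.2 *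
  (complex.Re (M w.1.1 w.1.2) * complex.Im (M w.2.1 w.2.2)).
rewrite (_ : \sum_i _ = S - \sum_(w : idx n * idx n) W w.1 w.2 *
    (complex.Im (M w.1.1 w.1.2) * complex.Re (M w.2.1 w.2.2))); last first.
  rewrite -sumrB; apply: eq_bigr => w _.
  by case: (M _ _) (M _ _) => [a b] [a' b'] /=; ring.
apply/eqP; rewrite subr_eq0; apply/eqP.
rewrite /S (reindex_inj (h := fun w => (w.2, w.1))) /=; last by move=> [? ?] [? ?] [-> ->].
by apply: eq_bigr => w _; rewrite Wsym [complex.Re _ * _]mulrC.
Qed.

(* The map with Choi matrix W, the index (i, a) of W standing for e_i (x) e_a. *)
Definition choi_map (n : nat) (W : idx n -> idx n -> R) (X : 'M[C]_n) : 'M[C]_n :=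
  \matrix_(a, b) \sum_(q : idx n) X q.1 q.2 * (W (q.1, a) (q.2, b))%:C.

Lemma choi_map_linear (n : nat) (W : idx n -> idx n -> R) : linear (choi_map W).
Proof.
move=> c X Y; apply/matrixP=> a b; rewrite !mxE mulr_sumr -big_split.
by apply: eq_bigr => q _ /=; rewrite !mxE; ring.
Qed.

Lemma unidxK (m n : nat) (i : 'I_m) (a : 'I_n) : unidx (mxvec_index i a) = (i, a).
Proof. by rewrite /unidx /mxvec_index cast_ordK enum_rankK. Qed.

Lemma sum_mxvec (V : nmodType) (m n : nat) (F : 'I_(m * n) -> V) :
  \sum_p F p = \sum_(q : 'I_m * 'I_n) F (mxvec_index q.1 q.2).
Proof.
rewrite (reindex _ (curry_mxvec_bij m n)) /=.
by apply: eq_bigr => -[].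
Qed.

Lemma ampE (m n : nat) (Phi : 'M[C]_n -> 'M[C]_n) X (l l' : 'I_m) a b :
  amp Phi X (mxvec_index l a) (mxvec_index l' b) = Phi (blk X l l') a b.
Proof. by rewrite mxE !unidxK. Qed.

Lemma amp_linear (m n : nat) (Phi : 'M[C]_n -> 'M[C]_n) :
  linear Phi -> linear (@amp m n Phi).
Proof.
move=> PhiL c X Y; apply/matrixP=> p q; rewrite !mxE.
have -> : blk (c *: X + Y) (unidx p).1 (unidx q).1 =
   c *: blk X (unidx p).1 (unidx q).1 + blk Y (unidx p).1 (unidx q).1.
  by apply/matrixP=> a b; rewrite !mxE.
by rewrite PhiL !mxE.
Qed.

(** A rank one input yields <psi, W psi> with psi = p_s^T V factoring through dimension k. Its real
    and imaginary parts are real matrices factoring through k + k. *)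
Lemma choi_map_kpositive (k n : nat) (W : idx n -> idx n -> R) :
  (forall p q, W p q = W q p) ->
  (forall (A : 'M[R]_(n, k + k)) B, 0 <= tform W (A *m B) (A *m B)) ->
  kpositive k (choi_map W).
Proof.
move=> Wsym W0 X /psd_spectral[P [d [d0 XE]]] v.
pose p_ s : 'M[C]_(k, n) := \matrix_(l, i) P s (mxvec_index l i).
pose V : 'M[C]_(k, n) := \matrix_(l, a) v (mxvec_index l a) 0.
have -> : ((map_mx conjc v)^T *m amp (choi_map W) X *m v) 0 0
   = \sum_s d s * hform W ((p_ s)^T *m V).
  rewrite mxE; under eq_bigr do rewrite mxE mulr_suml.
  rewrite sum_mxvec; under eq_bigr do rewrite sum_mxvec.
  have e (q p : 'I_k * 'I_n) :
     (map_mx conjc v)^T 0 (mxvec_index p.1 p.2) *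
       amp (choi_map W) X (mxvec_index p.1 p.2) (mxvec_index q.1 q.2) *
       v (mxvec_index q.1 q.2) 0
     = \sum_s d s * \sum_(ij : idx n) (W (ij.1, p.2) (ij.2, q.2))%:C *
         (((p_ s p.1 ij.1)^* * (V p.1 p.2)^*) * (p_ s q.1 ij.2 * V q.1 q.2)).
    rewrite ampE !mxE mulr_sumr mulr_suml.
    under eq_bigr => ij _ do rewrite mxE XE mulr_suml mulr_sumr mulr_suml.
    rewrite exchange_big; apply: eq_bigr => s _ /=.
    rewrite mulr_sumr; apply: eq_bigr => ij _; rewrite !mxE.
    by rewrite -!/(conjc _); ring.
  under eq_bigr do under eq_bigr do rewrite e.
  under eq_bigr do rewrite exchange_big.
  rewrite exchange_big; apply: eq_bigr => s _ /=.
  under eq_bigr do rewrite -mulr_sumr.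
  rewrite -mulr_sumr; congr (_ * _).
  rewrite /hform.
  under [RHS]eq_bigr => w _ do
    rewrite [in X in X^* * _]mxE [in X in _^* * X]mxE rmorph_sum mulr_suml mulr_sumr.
  under [RHS]eq_bigr do under eq_bigr do rewrite mulr_sumr mulr_sumr.
  rewrite !pair_big /=.
  (* One side groups the six indices as (i, a), (j, b), l, l', the other as (l', b), (l, a), (i,
     j). *)
  rewrite (reindex (fun z : ((idx n * idx n) * 'I_k) * 'I_k =>
     (((z.2, z.1.1.2.2), (z.1.2, z.1.1.1.2)), (z.1.1.1.1, z.1.1.2.1)))) /=; last first.
    exists (fun z : (('I_k * 'I_n) * ('I_k * 'I_n)) * idx n =>
       ((((z.2.1, z.1.2.2), (z.2.2, z.1.1.2)), z.1.2.1), z.1.1.1)).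
    + by move=> [[[[i a] [j b]] l] l'].
    + by move=> [[[l a] [l' b]] [i j]].
  apply: eq_bigr => -[[[[i a] [j b]] l] l'] _ /=.
  by rewrite !mxE rmorphM.
apply: sumr_ge0 => s _; apply: mulr_ge0 => //; rewrite hformE// ler0c.
set A := map_mx (@complex.Re R) (p_ s); set B := map_mx (@complex.Im R) (p_ s).
set E := map_mx (@complex.Re R) V; set F := map_mx (@complex.Im R) V.
have -> : map_mx (@complex.Re R) ((p_ s)^T *m V) =
   row_mx A^T (- B^T) *m col_mx E F.
  rewrite mul_row_col; apply/matrixP=> i a; rewrite !mxE Re_sum -big_split.
  apply: eq_bigr => l _ /=; rewrite !mxE.
  by case: (P _ _) (v _ _) => [x y] [x' y'] /=; ring.
have -> : map_mx (@complex.Im R) ((p_ s)^T *m V) =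
   row_mx A^T B^T *m col_mx F E.
  rewrite mul_row_col; apply/matrixP=> i a; rewrite !mxE Im_sum -big_split.
  apply: eq_bigr => l _ /=; rewrite !mxE.
  by case: (P _ _) (v _ _) => [x y] [x' y'] /=; ring.
by rewrite addr_ge0.
Qed.

(** * Operator norms *)

Lemma sqr_sum_le (K : realDomainType) (I : finType) (x : I -> K) :
  (\sum_i x i) ^+ 2 <= #|I|%:R * \sum_i x i ^+ 2.
Proof.
have : 0 <= \sum_i \sum_j (x i - x j) ^+ 2.
  by do 2![apply: sumr_ge0 => ? _]; exact: sqr_ge0.
have -> : \sum_i \sum_j (x i - x j) ^+ 2
   = 2 * (#|I|%:R * \sum_i x i ^+ 2) - 2 * (\sum_i x i) ^+ 2.
  have -> : \sum_i \sum_j (x i - x j) ^+ 2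
     = \sum_i (#|I|%:R * x i ^+ 2 + \sum_j x j ^+ 2 - 2 * (x i * \sum_j x j)).
    apply: eq_bigr => i _; rewrite 2!mulr_sumr mulr_natl -sumr_const -big_split -sumrB.
    by apply: eq_bigr => j _ /=; ring.
  by rewrite sumrB big_split /= -!mulr_sumr sumr_const -mulr_suml -mulr_natl; ring.
by lra.
Qed.

Lemma cabs2_ge0 (z : C) : 0 <= cabs2 z.
Proof. by rewrite addr_ge0 ?sqr_ge0. Qed.

Lemma cabs2M (x y : C) : cabs2 (x * y) = cabs2 x * cabs2 y.
Proof. by case: x y => [a b] [c d]; rewrite /cabs2 /=; ring. Qed.

Lemma cabs2_sum (I : finType) (z : I -> C) :
  cabs2 (\sum_i z i) <= #|I|%:R * \sum_i cabs2 (z i).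
Proof.
rewrite /cabs2 Re_sum Im_sum big_split mulrDr.
by apply: lerD; exact: sqr_sum_le.
Qed.

Definition vnorm2 (p : nat) (v : 'cV[C]_p) : R := \sum_i cabs2 (v i 0).

Definition frob2 (p : nat) (A : 'M[C]_p) : R := \sum_i \sum_j cabs2 (A i j).

Lemma vnorm2_ge0 (p : nat) (v : 'cV[C]_p) : 0 <= vnorm2 v.
Proof. by apply: sumr_ge0 => i _; exact: cabs2_ge0. Qed.

Lemma vnorm_le1 (p : nat) (v : 'cV[C]_p) : (vnorm v <= 1) = (vnorm2 v <= 1).
Proof. by rewrite /vnorm -[X in _ <= X]sqrtr1 ler_sqrt. Qed.

(** A crude bound, enough to show that the set defining [opnorm] is bounded above. *)
Lemma vnorm2_mul_le (p : nat) (A : 'M[C]_p) (v : 'cV[C]_p) :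
  vnorm2 (A *m v) <= p%:R * frob2 A * vnorm2 v.
Proof.
rewrite /frob2 -mulrA mulr_suml mulr_sumr; apply: ler_sum => i _.
rewrite mxE; apply: le_trans (cabs2_sum _) _; rewrite card_ord ler_wpM2l ?ler0n//.
rewrite mulr_suml; apply: ler_sum => j _; rewrite cabs2M ler_wpM2l ?cabs2_ge0//.
by rewrite /vnorm2 (bigD1 j)//= lerDl sumr_ge0// => k _; exact: cabs2_ge0.
Qed.

Lemma vnorm_mul_le (p : nat) (A : 'M[C]_p) (v : 'cV[C]_p) : vnorm v <= 1 ->
  vnorm (A *m v) <= Num.sqrt (p%:R * frob2 A).
Proof.
rewrite vnorm_le1 => v1; have f0 : 0 <= p%:R * frob2 A.
  by rewrite mulr_ge0 ?ler0n// sumr_ge0// => i _; rewrite sumr_ge0// => j _; exact: cabs2_ge0.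
rewrite ler_sqrt//; apply: le_trans (vnorm2_mul_le _ _) _.
by rewrite ler_piMr.
Qed.

Lemma vnorm_le_opnorm (p : nat) (A : 'M[C]_p) (v : 'cV[C]_p) :
  vnorm v <= 1 -> vnorm (A *m v) <= opnorm A.
Proof.
move=> v1; apply: ub_le_sup; last by exists v.
by exists (Num.sqrt (p%:R * frob2 A)) => _ [w /= w1 <-]; exact: vnorm_mul_le.
Qed.

Lemma vnorm0 (p : nat) : vnorm (0 : 'cV[C]_p) = 0.
Proof.
by rewrite /vnorm big1 ?sqrtr0// => i _; rewrite mxE /cabs2 /= expr0n addr0.
Qed.

Lemma opnorm_le (p : nat) (A : 'M[C]_p) (c : R) :
  (forall v, vnorm v <= 1 -> vnorm (A *m v) <= c) -> opnorm A <= c.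
Proof.
move=> h; apply: ge_sup; last by move=> _ [v /= v1 <-]; exact: h.
by exists (vnorm (A *m 0)), 0 => //=; rewrite vnorm0.
Qed.

Lemma entry_le_opnorm (p : nat) (A : 'M[C]_p) i j : opnorm A <= 1 -> cabs2 (A i j) <= 1.
Proof.
move=> A1; have e1 : vnorm (delta_mx j 0 : 'cV[C]_p) <= 1.
  rewrite vnorm_le1 /vnorm2 (bigD1 j)//= big1 ?addr0 => [|k /negPf kj]; rewrite mxE.
    by rewrite !eqxx /cabs2 /= expr1n expr0n addr0.
  by rewrite kj /cabs2 /= expr0n addr0.
have := le_trans (vnorm_le_opnorm A e1) A1.
rewrite vnorm_le1; apply: le_trans; rewrite -colE /vnorm2 (bigD1 i)//= mxE lerDl.
by apply: sumr_ge0 => k _; exact: cabs2_ge0.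
Qed.

(** A real [sup] dominates its set only if the set is bounded above. Here entries of a contraction
    have modulus at most 1, so the images of the matrix units bound T uniformly. *)
Lemma opnorm_le_mapnorm (p : nat) (T : 'M[C]_p -> 'M[C]_p) (X : 'M[C]_p) :
  linear T -> opnorm X <= 1 -> opnorm (T X) <= mapnorm T.
Proof.
move=> TL X1; apply: ub_le_sup; last by exists X.
pose T' : {linear 'M[C]_p -> 'M[C]_p} := HB.pack T (GRing.isLinear.Build _ _ _ _ T TL).
pose B := \sum_i \sum_j (#|{: 'I_p * 'I_p}|%:R * \sum_(q : 'I_p * 'I_p)
   cabs2 (T (delta_mx q.1 q.2) i j)).
exists (Num.sqrt (p%:R * B)) => _ [Y /= Y1 <-]; apply: opnorm_le => v v1.
apply: le_trans (vnorm_mul_le _ v1) _.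
have B0 : 0 <= B.
  do 2![apply: sumr_ge0 => ? _]; rewrite mulr_ge0 ?ler0n// sumr_ge0// => ? _.
  exact: cabs2_ge0.
rewrite ler_sqrt ?mulr_ge0 ?ler0n// ler_wpM2l ?ler0n//.
apply: ler_sum => i _; apply: ler_sum => j _.
have -> : T Y = \sum_(q : 'I_p * 'I_p) Y q.1 q.2 *: T (delta_mx q.1 q.2).
  rewrite -[T]/(T' : _ -> _) [in LHS](matrix_sum_delta Y) pair_big raddf_sum.
  by apply: eq_bigr => q _; exact: (linearZ_LR T').
rewrite summxE; apply: le_trans (cabs2_sum _) _; rewrite ler_wpM2l ?ler0n//.
apply: ler_sum => q _; rewrite mxE cabs2M ler_piMl ?cabs2_ge0//.
exact: entry_le_opnorm.
Qed.

Lemma opnorm_le_cbnorm (m n : nat) (Phi : 'M[C]_n -> 'M[C]_n) (X : 'M[C]_(m * n)) (c : R) :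
  linear Phi -> (0 < m)%N -> opnorm X <= 1 -> c <= opnorm (amp Phi X) ->
  (c%:E <= cbnorm Phi)%E.
Proof.
move=> PhiL m0 X1 cX.
apply: (@le_trans _ _ (mapnorm (@amp m n Phi))%:E).
  rewrite lee_fin; apply: le_trans cX _; apply: opnorm_le_mapnorm => //.
  exact: amp_linear.
by apply: ereal_sup_ubound; exists m.
Qed.

(** * The lower bound *)

Definition tform_op (K : nzRingType) (n : nat) (G : idx n -> idx n -> K) (M : 'M[K]_n) : 'M[K]_n :=
  \matrix_(i, a) \sum_q G (i, a) q * M q.1 q.2.

Lemma tform_dotmat (K : comNzRingType) (n : nat) (G : idx n -> idx n -> K) (M N : 'M[K]_n) :
  tform G M N = dotmat M (tform_op G N).
Proof.
rewrite /tform -(pair_big predT predT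
  (fun p q : idx n => G p q * (M p.1 p.2 * N q.1 q.2))) /=.
apply: eq_bigr => p _; rewrite mxE mulr_sumr; apply: eq_bigr => q _.
by rewrite -surjective_pairing; ring.
Qed.

(** The norm of a symmetric operator is its numerical radius: subtract the bounds at M + L^-1 G M
    and M - L^-1 G M. *)
Lemma sqnorm_tform_op (K : realFieldType) (n : nat) (G : idx n -> idx n -> K) (L : K) (M : 'M[K]_n) :
  (forall p q, G p q = G q p) -> 0 < L ->
  (forall N, `|tform G N N| <= L * sqnorm N) ->
  sqnorm (tform_op G M) <= L ^+ 2 * sqnorm M.
Proof.
move=> Gsym L0 hG; set N := tform_op G M.
have symf : tform G M N = tform G N M.
  rewrite /tform (reindex_inj (h := fun w => (w.2, w.1))) /=; last by move=> [? ?] [? ?] [-> ->].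
  by apply: eq_bigr => w _; rewrite Gsym [M _ _ * _]mulrC.
have e : tform G N M = sqnorm N.
  by rewrite tform_dotmat; apply: eq_bigr => q _; rewrite expr2.
have h1 := hG (M + L^-1 *: N); have h2 := hG (M + (- L^-1) *: N).
rewrite !ler_norml !tform_quad !sqnormE symf e in h1 h2.
have {h1}/andP[_ h1] := h1; have {h2}/andP[h2 _] := h2.
have : 2 * (L^-1 * sqnorm N) <= L * sqnorm M + L * (L^-1 ^+ 2 * sqnorm N).
  by move: h1 h2; rewrite sqrrN; nra.
have -> : L * (L^-1 ^+ 2 * sqnorm N) = L^-1 * sqnorm N by field; rewrite lt0r_neq0.
move=> h; have : L^-1 * sqnorm N <= L * sqnorm M by lra.
by rewrite ler_pdivrMl// mulrA -expr2.
Qed.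

Definition signW (n : nat) (e : {ffun idx n * idx n -> bool}) (t : R) (p q : idx n) : R :=
  (p == q)%:R / n%:R + t * signG R e p q.

Lemma signWC (n : nat) (e : {ffun idx n * idx n -> bool}) (t : R) p q :
  signW e t p q = signW e t q p.
Proof. by rewrite /signW eq_sym signGC. Qed.

Lemma tform_signW (n : nat) (e : {ffun idx n * idx n -> bool}) (t : R) (M : 'M[R]_n) :
  tform (signW e t) M M = sqnorm M / n%:R + t * tform (signG R e) M M.
Proof.
rewrite /tform mulr_sumr.
under eq_bigr do rewrite mulrDl -[X in _ + X]mulrA.
rewrite big_split; congr (_ + _) => /=.
rewrite -(pair_big predT predT
  (fun p q : idx n => (p == q)%:R / n%:R * (M p.1 p.2 * M q.1 q.2))) /=.
rewrite mulr_suml; apply: eq_bigr => p _.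
rewrite (bigD1 p)//= big1 => [|q /negPf qp]; last by rewrite eq_sym qp !mul0r.
by rewrite eqxx mulr1n; ring.
Qed.

Lemma signW_unital (n : nat) (e : {ffun idx n * idx n -> bool}) (t : R) :
  (0 < n)%N -> unital (choi_map (signW e t)).
Proof.
move=> n0; have n0' : (n%:R : R) != 0 by rewrite pnatr_eq0 -lt0n.
apply/matrixP=> a b; rewrite !mxE.
rewrite -(pair_big predT predT
  (fun i j : 'I_n => (1%:M : 'M[C]_n) i j * (signW e t (i, a) (j, b))%:C)) /=.
transitivity (\sum_(i < n) ((a == b)%:R / n%:R : R)%:C).
  apply: eq_bigr => i _; rewrite (bigD1 i)//= big1 ?addr0 => [|j /negPf ji].
    rewrite mxE eqxx mul1r /signW signG_offdiag ?eqxx//= mulr0 addr0.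
    by rewrite xpair_eqE eqxx.
  by rewrite mxE eq_sym ji mul0r.
rewrite sumr_const card_ord -rmorphMn /= -mulr_natl mulrCA divff// mulr1.
by case: (a == b).
Qed.

(** The transposed indexing undoes the flip in [witness], which therefore acts on these matrices
    through [tform_op G]. *)
Definition re_mx (n : nat) (v : 'cV[C]_(n * n)) : 'M[R]_n :=
  \matrix_(i, l) complex.Re (v (mxvec_index l i) 0).

Definition im_mx (n : nat) (v : 'cV[C]_(n * n)) : 'M[R]_n :=
  \matrix_(i, l) complex.Im (v (mxvec_index l i) 0).

Lemma vnorm2_re_im (n : nat) (v : 'cV[C]_(n * n)) :
  vnorm2 v = sqnorm (re_mx v) + sqnorm (im_mx v).
Proof.
rewrite /vnorm2 sum_mxvec -big_split (reindex_inj (h := fun w => (w.2, w.1))) /=.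
  by apply: eq_bigr => q _; rewrite !mxE.
by move=> [? ?] [? ?] [-> ->].
Qed.

(* The flip exchanges the roles of the two tensor factors of G, so that pairing
   with the maximally entangled vector below produces the sum of the squares of G. *)
Definition witness (n : nat) (G : idx n -> idx n -> R) (L : R) : 'M[C]_(n * n) :=
  \matrix_(p, q) (((unidx p == unidx q)%:R
    + L^-1 * G ((unidx p).2, (unidx p).1) ((unidx q).2, (unidx q).1)) / 2)%:C.

Lemma witness_mul (n : nat) (G : idx n -> idx n -> R) (L : R) (v : 'cV[C]_(n * n)) :
  re_mx (witness G L *m v) = 2^-1 *: (re_mx v + L^-1 *: tform_op G (re_mx v)) /\
  im_mx (witness G L *m v) = 2^-1 *: (im_mx v + L^-1 *: tform_op G (im_mx v)).
Proof.
have aux (f : 'I_n * 'I_n -> R) i l :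
   \sum_(q : 'I_n * 'I_n) ((((l, i) == q)%:R + L^-1 * G (i, l) (q.2, q.1)) / 2 * f q)
   = 2^-1 * (f (l, i) + L^-1 * \sum_q G (i, l) q * f (q.2, q.1)).
  transitivity (\sum_(q : 'I_n * 'I_n) 2^-1 * (((l, i) == q)%:R * f q)
     + \sum_(q : 'I_n * 'I_n) 2^-1 * (L^-1 * (G (i, l) (q.2, q.1) * f q))).
    by rewrite -big_split; apply: eq_bigr => q _ /=; ring.
  rewrite -!mulr_sumr -mulrDr; congr (_ * (_ + _)).
    rewrite (bigD1 (l, i))//= eqxx mul1r big1 ?addr0// => q /negPf ql.
    by rewrite eq_sym ql mul0r.
  congr (_ * _); rewrite (reindex_inj (h := fun w => (w.2, w.1))) /=.
    by apply: eq_bigr => -[].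
  by move=> [? ?] [? ?] [-> ->].
split; apply/matrixP=> i l; rewrite !mxE ?Re_sum ?Im_sum sum_mxvec.
  transitivity (\sum_(q : 'I_n * 'I_n) ((((l, i) == q)%:R + L^-1 * G (i, l) (q.2, q.1)) / 2
     * complex.Re (v (mxvec_index q.1 q.2) 0))).
    apply: eq_bigr => q _; rewrite mxE !unidxK /= -surjective_pairing.
    by case: (v _ _) => [x y] /=; rewrite mul0r subr0.
  by rewrite aux; congr (_ * (_ + _ * _)); apply: eq_bigr => q _; rewrite mxE.
transitivity (\sum_(q : 'I_n * 'I_n) ((((l, i) == q)%:R + L^-1 * G (i, l) (q.2, q.1)) / 2
   * complex.Im (v (mxvec_index q.1 q.2) 0))).
  apply: eq_bigr => q _; rewrite mxE !unidxK /= -surjective_pairing.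
  by case: (v _ _) => [x y] /=; rewrite mul0r addr0.
by rewrite aux; congr (_ * (_ + _ * _)); apply: eq_bigr => q _; rewrite mxE.
Qed.

(** The real operator L^-1 G is a contraction acting separately on real and imaginary parts, and the
    average of the identity with a contraction is a contraction. *)
Lemma opnorm_witness (n : nat) (G : idx n -> idx n -> R) (L : R) :
  (forall p q, G p q = G q p) -> 0 < L ->
  (forall N, `|tform G N N| <= L * sqnorm N) ->
  opnorm (witness G L) <= 1.
Proof.
move=> Gsym L0 hG; apply: opnorm_le => v; rewrite !vnorm_le1; apply: le_trans.
rewrite !vnorm2_re_im; have [-> ->] := witness_mul G L v.
have aux (N : 'M[R]_n) : sqnorm (2^-1 *: (N + L^-1 *: tform_op G N)) <= sqnorm N.
  have h : L^-1 ^+ 2 * sqnorm (tform_op G N) <= sqnorm N.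
    by rewrite exprVn ler_pdivrMl ?exprn_gt0//; exact: sqnorm_tform_op.
  have := sqnorm_ge0 (N + (- L^-1) *: tform_op G N).
  by rewrite sqnormZ !sqnormE sqrrN; move: h; lra.
by apply: lerD.
Qed.

(** The left side is Re <w, Y w> for the maximally entangled unit vector w; Cauchy-Schwarz compares
    it with the entries of Y w at positions (l, l). *)
Lemma entangled_le_opnorm (n : nat) (Y : 'M[C]_(n * n)) : (0 < n)%N ->
  (\sum_l \sum_m complex.Re (Y (mxvec_index l l) (mxvec_index m m))) / n%:R <= opnorm Y.
Proof.
move=> n0; have n0' : (n%:R : R) != 0 by rewrite pnatr_eq0 -lt0n.
pose t : R := (Num.sqrt n%:R)^-1.
have t2 : t ^+ 2 = n%:R^-1 by rewrite exprVn sqr_sqrtr ?ler0n.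
pose w : 'cV[C]_(n * n) :=
  \col_p (((unidx p).1 == (unidx p).2)%:R * t)%:C.
have wE l m : w (mxvec_index l m) 0 = ((l == m)%:R * t)%:C by rewrite mxE unidxK.
have w1 : vnorm w <= 1.
  rewrite vnorm_le1 /vnorm2 sum_mxvec.
  rewrite -(pair_big predT predT (fun l m : 'I_n => cabs2 (w (mxvec_index l m) 0))) /=.
  under eq_bigr => l _.
    rewrite (bigD1 l)//= big1 => [|m /negPf ml]; last first.
      by rewrite wE eq_sym ml mul0r /cabs2 /= expr0n addr0.
    rewrite wE eqxx mul1r /cabs2 /= t2 expr0n !addr0; over.
  by rewrite sumr_const card_ord -[leLHS]mulr_natl divff.
apply: le_trans (vnorm_le_opnorm Y w1).
pose b l := \sum_m complex.Re (Y (mxvec_index l l) (mxvec_index m m)).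
have bE l : complex.Re ((Y *m w) (mxvec_index l l) 0) = b l * t.
  rewrite mxE Re_sum sum_mxvec.
  rewrite -(pair_big predT predT (fun i m : 'I_n =>
     complex.Re (Y (mxvec_index l l) (mxvec_index i m) * w (mxvec_index i m) 0))) /=.
  rewrite mulr_suml; apply: eq_bigr => m _.
  rewrite (bigD1 m)//= big1 ?addr0 => [|i /negPf im]; rewrite wE.
    by rewrite eqxx mul1r; case: (Y _ _) => x y /=; rewrite mulr0 subr0.
  by rewrite eq_sym im mul0r mulr0.
apply: le_trans (ler_norm _) _; rewrite -sqrtr_sqr ler_sqrt ?vnorm2_ge0//.
apply: le_trans (_ : \sum_l (b l * t) ^+ 2 <= _).
  have -> : \sum_l (b l * t) ^+ 2 = (\sum_l b l ^+ 2) / n%:R.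
    by rewrite mulr_suml; apply: eq_bigr => l _; rewrite exprMn t2.
  have := sqr_sum_le b; rewrite card_ord => h.
  rewrite exprMn exprVn ler_pdivrMr ?exprn_gt0 ?ltr0n//; apply: le_trans h _.
  by rewrite le_eqVlt; apply/orP; left; apply/eqP; field.
rewrite -/(vnorm2 _) /vnorm2 sum_mxvec.
rewrite -(pair_big predT predT (fun l m : 'I_n => cabs2 ((Y *m w) (mxvec_index l m) 0))) /=.
apply: ler_sum => l _; rewrite (bigD1 l)//= -bE /cabs2 -addrA lerDl.
by rewrite addr_ge0 ?sqr_ge0// sumr_ge0// => m _; rewrite addr_ge0 ?sqr_ge0.
Qed.

Lemma sum_signG_sqr (n : nat) (e : {ffun idx n * idx n -> bool}) :
  \sum_p \sum_q signG R e p q ^+ 2 = (n%:R * (n%:R - 1)) ^+ 2.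
Proof.
have c (i : 'I_n) : \sum_j (i != j)%:R = n%:R - 1 :> R.
  have -> : n%:R = \sum_(j < n) (1 : R) by rewrite sumr_const card_ord.
  rewrite [in RHS](bigD1 i)//= addrAC subrr add0r (bigD1 i)//= eqxx add0r.
  by apply: eq_bigr => j ji; rewrite eq_sym ji.
under eq_bigr do under eq_bigr do rewrite signG_sqr -mulnb natrM.
transitivity (\sum_(p : idx n) ((n%:R - 1) ^+ 2 : R)).
  apply: eq_bigr => p _.
  rewrite -(pair_big predT predT (fun j b : 'I_n => (p.1 != j)%:R * (p.2 != b)%:R : R)) /=.
  by under eq_bigr do rewrite -mulr_sumr c; rewrite -mulr_suml c expr2.
by rewrite sumr_const card_prod card_ord -[LHS]mulr_natl natrM; ring.
Qed.

(** After the flip this is the entrywise pairing of 1/n + t G with (1 + L^-1 G) / 2. Cross terms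
    vanish because G is zero on the diagonal. *)
Lemma sum_amp_witness (n : nat) (e : {ffun idx n * idx n -> bool}) (t L : R) : (0 < n)%N ->
  \sum_l \sum_m complex.Re (amp (choi_map (signW e t)) (witness (signG R e) L)
     (mxvec_index l l) (mxvec_index m m))
  = n%:R / 2 + t / (2 * L) * (n%:R * (n%:R - 1)) ^+ 2.
Proof.
move=> n0; have n0' : (n%:R : R) != 0 by rewrite pnatr_eq0 -lt0n.
transitivity (\sum_p \sum_q (((p == q)%:R / (2 * n%:R)) + t / (2 * L) * signG R e p q ^+ 2)).
  transitivity (\sum_l \sum_m \sum_(ij : idx n)
     (((((ij.1, l) == (ij.2, m) :> idx n)%:R / (2 * n%:R))
       + t / (2 * L) * signG R e (ij.1, l) (ij.2, m) ^+ 2) : R)).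
    apply: eq_bigr => l _; apply: eq_bigr => m _; rewrite ampE mxE Re_sum.
    apply: eq_bigr => ij _; rewrite !mxE !unidxK /= mulr0 subr0 /signW.
    rewrite !xpair_eqE andbC.
    have [/andP[/eqP-> /eqP->]|_] := boolP ((_ == _) && (_ == _)).
      by rewrite signG_offdiag ?eqxx//= expr0n !mulr0 !addr0; field.
    by rewrite !invfM mulr0n; ring.
  rewrite [LHS]pair_big [LHS]pair_big [RHS]pair_big /=.
  rewrite (reindex (fun z : idx n * idx n => ((z.1.2, z.2.2), (z.1.1, z.2.1)))) /=.
    by apply: eq_bigr => -[[i a] [j b]] _.
  exists (fun z : ('I_n * 'I_n) * idx n => ((z.2.1, z.1.1), (z.2.2, z.1.2))).
  - by move=> [[? ?] [? ?]].
  - by move=> [[? ?] [? ?]].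
under eq_bigr do rewrite big_split /= -mulr_sumr -mulr_suml.
rewrite big_split /= -mulr_sumr sum_signG_sqr; congr (_ + _).
rewrite -mulr_suml; under eq_bigr => p _.
  rewrite (bigD1 p)//= big1 => [|q /negPf qp]; last by rewrite eq_sym qp.
  rewrite eqxx addr0; over.
by rewrite sumr_const card_prod card_ord natrM; field.
Qed.

Theorem mainTheorem8 :
  exists c : R, 0 < c /\
    forall n k : nat, (1 <= k)%N -> (k <= n)%N ->
      exists Phi : {linear 'M[C]_n -> 'M[C]_n},
        unital Phi /\ kpositive k Phi /\
        ((c * Num.sqrt (n%:R / k%:R))%:E <= cbnorm Phi)%E.
Proof.
(* D comes from t / (2 L) = 1 / (D n^2 s); the further 2 absorbs the factor in sqrt(n/k) <= 2 n /
   s. *)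
pose D : R := 2 * (192 * 192); exists (1 / (2 * D)); split; first by rewrite /D; lra.
move=> n k k1 kn; have n1 : (0 < n)%N := leq_trans k1 kn.
have [||e he] := @exists_signs R n (k + k) n; rewrite ?muln_gt0 ?addn_gt0 ?k1 ?n1//.
have n0 : 0 < n%:R :> R by rewrite ltr0n.
have k0 : 0 < k%:R :> R by rewrite ltr0n.
pose s : R := Num.sqrt ((k + k) * n)%:R.
have s2 : s ^+ 2 = 2 * k%:R * n%:R by rewrite sqr_sqrtr ?ler0n// natrM natrD; ring.
have s1 : 1 <= s.
  by rewrite -sqrtr1 ler_sqrt ?ler0n// ler1n muln_gt0 addn_gt0 k1 n1.
have s0 : 0 < s by apply: lt_le_trans s1.
(* Chosen so that t * 192 s = 1/n: the identity part of W exactly compensates the bound on the sign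
   part. *)
pose t : R := (192 * n%:R * s)^-1.
have t0 : 0 < t by rewrite invr_gt0 !mulr_gt0.
pose L : R := 192 * n%:R.
have L0 : 0 < L by rewrite mulr_gt0.
have PhiL := choi_map_linear (signW e t).
pose Phi : {linear 'M[C]_n -> 'M[C]_n} :=
  HB.pack (choi_map (signW e t)) (GRing.isLinear.Build _ _ _ _ _ PhiL).
exists Phi; split; first exact: signW_unital.
split.
  apply: choi_map_kpositive => [p q|A B]; first exact: signWC.
  have := he (k + k)%N; rewrite eqxx => /(_ isT A B); rewrite -/s ler_norml => /andP[h _].
  rewrite tform_signW.
  have -> : sqnorm (A *m B) / n%:R = t * (192 * s * sqnorm (A *m B)).
    by rewrite /t; field; rewrite !lt0r_neq0.
  by rewrite -mulrDr; apply: mulr_ge0; [rewrite ltW|rewrite -lerBlDl sub0r].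
have hL N : `|tform (signG R e) N N| <= L * sqnorm N.
  have := he n; rewrite eqxx orbT => /(_ isT 1%:M N); rewrite mul1mx.
  by rewrite natrM -expr2 sqrtr_sqr (ger0_norm (ltW n0)).
apply: (opnorm_le_cbnorm PhiL n1 (opnorm_witness (@signGC R n e) L0 hL)).
apply: le_trans (entangled_le_opnorm _ n1).
rewrite sum_amp_witness//.
have -> : (n%:R / 2 + t / (2 * L) * (n%:R * (n%:R - 1)) ^+ 2) / n%:R
   = 1 / 2 + (n%:R - 1) ^+ 2 / (D * n%:R * s).
  by rewrite /t /L /D; field; rewrite !lt0r_neq0.
have rho : Num.sqrt (n%:R / k%:R) <= 2 * n%:R / s :> R.
  rewrite -[leRHS]ger0_norm; last by rewrite divr_ge0 ?mulr_ge0 ?ltW.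
  rewrite -sqrtr_sqr ler_sqrt ?sqr_ge0// exprMn exprVn s2.
  rewrite (_ : (2 * n%:R) ^+ 2 / (2 * k%:R * n%:R) = 2 * (n%:R / k%:R)); last first.
    by field; rewrite !lt0r_neq0.
  have nk : 0 <= n%:R / k%:R :> R by rewrite divr_ge0 ?ltW.
  by lra.
have D0 : 0 < D by rewrite /D; lra.
apply: le_trans (ler_wpM2l _ rho) _; first by rewrite divr_ge0// mulr_ge0// ltW.
have -> : 1 / (2 * D) * (2 * n%:R / s) = n%:R ^+ 2 / (D * n%:R * s).
  by field; rewrite !lt0r_neq0.
have Dns : 0 < D * n%:R * s by rewrite !mulr_gt0.
(* The summand 1/2 pays for replacing (n - 1)^2 by n^2: the loss is below 2 n, and D n s / 2 >= 2 n
   since s >= 1. This includes n = 1. *)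
rewrite ler_pdivrMr// mulrDl divfK ?lt0r_neq0//.
have ns : n%:R <= n%:R * s by rewrite ler_peMr// ltW.
have : 2 * n%:R <= 1 / 2 * (D * n%:R * s) by rewrite -mulrA /D; lra.
have -> : (n%:R - 1) ^+ 2 = n%:R ^+ 2 - 2 * n%:R + 1 :> R by ring.
by lra.
Qed.
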